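(* Let $n\ge 4$ and let $x_1,x_2,\dots,x_n$ be $n$ real numbers, with arithmetic mean $A$ and second, third and fourth moments $m_2'$, $m_3'$, $m_4'$. Then $$\left(nA^{2}-m_{2}'\right)m_{4}'\geq \frac{1}{6(n-2)}\Big(n^{4}A^{6}-n^{3}(n+4)\,m_{2}'A^{4}+4n^{2}(n-1)\,m_{3}'A^{3}+9n^{2}m_{2}'^{\,2}A^{2}+4n(n-5)\,m_{2}'m_{3}'A-3n(n-2)\,m_{2}'^{\,3}-4(n-3)\,m_{3}'^{\,2}\Big).$$
   Context: For real numbers $x_1,\dots,x_n$: $A=\frac1n\sum_{i=1}^n x_i$, and $m_r'=\frac1n\sum_{i=1}^n x_i^r$ for $r=2,3,4$; $m_r'^{\,k}$ means $(m_r')^k$. *)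

(* Defs.v *)
From mathcomp Require Import all_boot all_order all_algebra.
From mathcomp Require Import reals.

Set Implicit Arguments.
Unset Strict Implicit.
Unset Printing Implicit Defensive.

Import Order.TTheory GRing.Theory Num.Theory.

Local Open Scope ring_scope.

Definition amean (R : realType) (n : nat) (x : 'I_n -> R) : R :=
  (\sum_(i < n) x i) / n%:R.

(* Raw moment, i.e. taken about the origin and not about the mean. *)
Definition moment (R : realType) (n : nat) (x : 'I_n -> R) (r : nat) : R :=
  (\sum_(i < n) x i ^+ r) / n%:R.

(* Main.v *)
(* With p_k the power sums and e_k the elementary symmetric functions, the claim
   is Newton's inequality 4 (n-2) e_2 e_4 <= 3 (n-3) e_3^2, in which e_4 is
   linear in p_4.  For real x_i of arbitrary sign it follows from the identity
     12 (3 (n-3) e_3^2 - 4 (n-2) e_2 e_4)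
       = sum_(i < j) (x_i - x_j)^2 (q_1^4 + 3 q_2^2 - 4 q_1 q_3),
   where q_k = p_k - x_i^k - x_j^k is a power sum of the other variables, because
   the last factor is itself a sum of squares. *)
Require Import Defs.
From mathcomp Require Import all_boot all_order all_algebra.
From mathcomp Require Import reals.
From mathcomp Require Import ring lra.

Set Implicit Arguments.
Unset Strict Implicit.
Unset Printing Implicit Defensive.

Import Order.TTheory GRing.Theory Num.Theory.

Local Open Scope ring_scope.

Lemma sum_quartic (R : comNzRingType) (n : nat) (x : 'I_n -> R)
    (c0 c1 c2 c3 c4 : R) :
  \sum_(i < n) (c0 + c1 * x i + c2 * x i ^+ 2 + c3 * x i ^+ 3 + c4 * x i ^+ 4) =
  c0 * n%:R + c1 * (\sum_(i < n) x i) + c2 * (\sum_(i < n) x i ^+ 2)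
  + c3 * (\sum_(i < n) x i ^+ 3) + c4 * (\sum_(i < n) x i ^+ 4).
Proof.
by rewrite !big_split /= -!mulr_sumr sumr_const card_ord mulr_natr.
Qed.

(** The form is [(q 1 ^+ 2 - q 2) ^+ 2] plus twice the sums [mixed] and [offdiag] below, whose [q 4]
    terms cancel. In [offdiag], [q 2 - x i ^+ 2] is the sum of the squares of the other
    variables. *)
Lemma power_sums_quartic_ge0 (R : realDomainType) (I : finType) (P : pred I)
    (x : I -> R) (q : nat -> R) :
  (forall k, q k = \sum_(i | P i) x i ^+ k) ->
  0 <= q 1 ^+ 4 + 3 * q 2 ^+ 2 - 4 * q 1 * q 3.
Proof.
move=> qE.
have mixed : \sum_(i | P i) (x i * (q 1 - x i)) ^+ 2
             = q 1 ^+ 2 * q 2 - 2 * q 1 * q 3 + q 4.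
  rewrite (eq_bigr (fun i => q 1 ^+ 2 * x i ^+ 2 + (- (2 * q 1)) * x i ^+ 3
                             + x i ^+ 4)); last by move=> i _; ring.
  by rewrite !big_split /= -!mulr_sumr -!qE mulNr.
have offdiag : \sum_(i | P i) x i ^+ 2 * (q 2 - x i ^+ 2) = q 2 ^+ 2 - q 4.
  rewrite (eq_bigr (fun i => q 2 * x i ^+ 2 - x i ^+ 4));
    last by move=> i _; ring.
  by rewrite sumrB -mulr_sumr -!qE -expr2.
have mixed_ge0 : 0 <= q 1 ^+ 2 * q 2 - 2 * q 1 * q 3 + q 4.
  by rewrite -mixed; apply: sumr_ge0 => i _; apply: sqr_ge0.
have offdiag_ge0 : 0 <= q 2 ^+ 2 - q 4.
  rewrite -offdiag; apply: sumr_ge0 => i Pi; apply: mulr_ge0 (sqr_ge0 _) _.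
  rewrite qE (bigD1 i) //= addrAC subrr add0r.
  by apply: sumr_ge0 => j _; apply: sqr_ge0.
rewrite (_ : _ - _ = (q 1 ^+ 2 - q 2) ^+ 2
   + 2 * (q 1 ^+ 2 * q 2 - 2 * q 1 * q 3 + q 4) + 2 * (q 2 ^+ 2 - q 4));
  last by ring.
by rewrite !addr_ge0 ?sqr_ge0 ?mulr_ge0 // ler0n.
Qed.

(** On the right the factors in [p] are 6 e_3, 2 e_2 and 24 e_4. The leading 2 appears because
    ordered pairs count each pair twice. Summing over [j], then over [i], reduces the left side to
    power sums. *)
Lemma newton3_sum_of_squares (R : comNzRingType) (n : nat) (x : 'I_n -> R)
    (p : nat -> R) :
  (forall k, p k = \sum_(i < n) x i ^+ k) ->
  \sum_(i < n) \sum_(j < n) (x i - x j) ^+ 2 *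
     ((p 1 - x i - x j) ^+ 4 + 3 * (p 2 - x i ^+ 2 - x j ^+ 2) ^+ 2
      - 4 * (p 1 - x i - x j) * (p 3 - x i ^+ 3 - x j ^+ 3)) =
  2 * ((n%:R - 3) * (p 1 ^+ 3 - 3 * p 1 * p 2 + 2 * p 3) ^+ 2
       - (n%:R - 2) * (p 1 ^+ 2 - p 2)
         * (p 1 ^+ 4 - 6 * p 1 ^+ 2 * p 2 + 3 * p 2 ^+ 2 + 8 * p 1 * p 3
            - 6 * p 4)).
Proof.
move=> pE; set a := p 1; set b := p 2; set c := p 3; set d := p 4.
(* The cubic and quartic terms in [x j] of the second factor cancel: it is
   [k0 s + k1 s * x j + k2 s * x j ^+ 2] with [s = x i]. *)
pose k0 s := (a ^+ 4 + 3 * b ^+ 2 - 4 * a * c) + 4 * (c - a ^+ 3) * s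
             + 6 * (a ^+ 2 - b) * s ^+ 2.
pose k1 s := 4 * (c - a ^+ 3) + 12 * a ^+ 2 * s - 12 * a * s ^+ 2.
pose k2 s := 6 * (a ^+ 2 - b) - 12 * a * s + 12 * s ^+ 2.
have inner i : \sum_(j < n) (x i - x j) ^+ 2 *
     ((a - x i - x j) ^+ 4 + 3 * (b - x i ^+ 2 - x j ^+ 2) ^+ 2
      - 4 * (a - x i - x j) * (c - x i ^+ 3 - x j ^+ 3)) =
   k0 (x i) * (n%:R * x i ^+ 2 - 2 * x i * a + b)
   + k1 (x i) * (x i ^+ 2 * a - 2 * x i * b + c)
   + k2 (x i) * (x i ^+ 2 * b - 2 * x i * c + d).
  set s := x i.
  transitivity (\sum_(j < n) (s ^+ 2 * k0 s + (s ^+ 2 * k1 s - 2 * s * k0 s) * x j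
      + (s ^+ 2 * k2 s - 2 * s * k1 s + k0 s) * x j ^+ 2
      + (k1 s - 2 * s * k2 s) * x j ^+ 3 + k2 s * x j ^+ 4)).
    by apply: eq_bigr => j _; rewrite /k0 /k1 /k2; ring.
  rewrite sum_quartic -(pE 1%N) -(pE 2%N) -(pE 3%N) -(pE 4%N) -/a -/b -/c -/d.
  by ring.
under eq_bigr => i _ do rewrite inner.
(* These are the coefficients of [k0] in [s]; [e1] and [e2] are also the constant terms of [k1] and
   [k2]. The outer summand is again quartic, now in [x i], so [sum_quartic] applies a second
   time. *)
pose e0 := a ^+ 4 + 3 * b ^+ 2 - 4 * a * c.
pose e1 := 4 * (c - a ^+ 3).
pose e2 := 6 * (a ^+ 2 - b).
transitivity (\sum_(i < n) (
     (e0 * b + e1 * c + e2 * d)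
     + (- 2 * e0 * a + e1 * b - 2 * e1 * b + 12 * a ^+ 2 * c
        - 2 * e2 * c - 12 * a * d) * x i
     + (e0 * n%:R - 2 * e1 * a + e2 * b + e1 * a - 24 * a ^+ 2 * b
        - 12 * a * c + e2 * b + 24 * a * c + 12 * d) * x i ^+ 2
     + (e1 * n%:R - 2 * e2 * a + 12 * a ^+ 3 + 24 * a * b
        - 12 * a * b - 24 * c) * x i ^+ 3
     + (e2 * n%:R - 12 * a ^+ 2 + 12 * b) * x i ^+ 4)).
  by apply: eq_bigr => i _; rewrite /k0 /k1 /k2 /e0 /e1 /e2; ring.
rewrite sum_quartic -(pE 1%N) -(pE 2%N) -(pE 3%N) -(pE 4%N) -/a -/b -/c -/d.
by rewrite /e0 /e1 /e2; ring.
Qed.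

Lemma newton3_power_sums (R : realDomainType) (n : nat) (x : 'I_n -> R)
    (p : nat -> R) :
  (forall k, p k = \sum_(i < n) x i ^+ k) ->
  (n%:R - 2) * (p 1 ^+ 2 - p 2)
    * (p 1 ^+ 4 - 6 * p 1 ^+ 2 * p 2 + 3 * p 2 ^+ 2 + 8 * p 1 * p 3 - 6 * p 4)
  <= (n%:R - 3) * (p 1 ^+ 3 - 3 * p 1 * p 2 + 2 * p 3) ^+ 2.
Proof.
move=> pE; rewrite -subr_ge0 -(pmulr_rge0 _ (ltr0n R 2)).
rewrite -(@newton3_sum_of_squares _ _ x p) //.
apply: sumr_ge0 => i _; apply: sumr_ge0 => j _.
(* On the diagonal [x i ^+ k] would be removed twice, leaving no power sum of the other variables;
   there the factor [(x i - x j) ^+ 2] vanishes instead. *)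
have [->|neq_ij] := eqVneq i j; first by rewrite subrr expr0n mul0r.
apply: mulr_ge0 (sqr_ge0 _) _.
have others k :
    p k - x i ^+ k - x j ^+ k = \sum_(l | (l != i) && (l != j)) x l ^+ k.
  rewrite pE (bigD1 i) //= (bigD1 j) /=; last by rewrite eq_sym.
  by rewrite -addrA -opprD addrA addrC addKr.
have := power_sums_quartic_ge0 (fun k => others k).
by rewrite !expr1.
Qed.

Theorem theorem2p7 (R : realType) (n : nat) (hn : (4 <= n)%N) (x : 'I_n -> R) :
  let N : R := n%:R in
  let A := amean x in
  let m2 := moment x 2 in
  let m3 := moment x 3 in
  let m4 := moment x 4 in
  (N * A ^+ 2 - m2) * m4 >=
  1 / (6 * (N - 2)) *
    (N ^+ 4 * A ^+ 6
     - N ^+ 3 * (N + 4) * m2 * A ^+ 4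
     + 4 * N ^+ 2 * (N - 1) * m3 * A ^+ 3
     + 9 * N ^+ 2 * m2 ^+ 2 * A ^+ 2
     + 4 * N * (N - 5) * m2 * m3 * A
     - 3 * N * (N - 2) * m2 ^+ 3
     - 4 * (N - 3) * m3 ^+ 2).
Proof.
cbv zeta; set N : R := n%:R; set A := amean x.
set m2 := moment x 2; set m3 := moment x 3; set m4 := moment x 4.
have N4 : 4 <= N by rewrite ler_nat.
have N0 : N != 0 by rewrite gt_eqF //; lra.
have N2 : 0 < 6 * (N - 2) by lra.
have /= := @newton3_power_sums _ _ x _ (fun k => erefl); rewrite -/N.
have -> : \sum_(i < n) x i ^+ 1 = N * A by rewrite mulrC divfK.
have -> : \sum_(i < n) x i ^+ 2 = N * m2 by rewrite mulrC divfK.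
have -> : \sum_(i < n) x i ^+ 3 = N * m3 by rewrite mulrC divfK.
have -> : \sum_(i < n) x i ^+ 4 = N * m4 by rewrite mulrC divfK.
rewrite -subr_ge0 => newton.
rewrite mul1r mulrC ler_pdivrMr // -subr_ge0.
(* With [N * A], [N * m2], [N * m3], [N * m4] as power sums, e_3^2 and e_2 e_4 each contain a factor
   [N ^+ 2], so the difference in [newton] is exactly [N ^+ 2] times the one in the goal. *)
have N2_gt0 : 0 < N ^+ 2 by rewrite exprn_gt0 //; lra.
rewrite -(pmulr_rge0 _ N2_gt0).
apply: le_trans newton _; rewrite le_eqVlt; apply/orP; left; apply/eqP.
by ring.
Qed.
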